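(* Let $X$ be a $d$-Leray simplicial complex on vertex set $V$, and let $M$ be a matroid on $V$ of rank $r\geq d+1$ with rank function $\rho$. Let $1\leq k\leq d+1$. Assume that $X$ contains every set $\sigma\subset V$ with $|\sigma|=d+1$ and $\rho(\sigma)\geq k$. Then there is some $\tau\in X$ such that $\rho(V\setminus\tau)\leq k-1$.
   Context: A simplicial complex $X$ on vertex set $V$ is a family of subsets of the finite set $V$ closed under taking subsets. $X$ is $d$-Leray if every induced subcomplex $X[U]=\{\sigma\in X:\sigma\subset U\}$, $U\subset V$ (including $X$ itself), has trivial reduced homology in all dimensions $\geq d$. For a matroid $M$ on $V$, $\rho(W)$ is the maximum size of an independent subset of $W$, and the rank of $M$ is $\rho(V)$. *)

(* Defs.v *)
From mathcomp Require Import all_boot all_order all_algebra.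

Set Implicit Arguments.
Unset Strict Implicit.
Unset Printing Implicit Defensive.

Import GRing.Theory.
Local Open Scope ring_scope.

Definition simplicial_complex (V : finType) (X : {set {set V}}) : Prop :=
  forall s t : {set V}, s \in X -> t \subset s -> t \in X.

Definition induced (V : finType) (X : {set {set V}}) (U : {set V}) :
  {set {set V}} := [set s in X | s \subset U].

(* Chains with coefficients in R are functions on {set V}: simplices are
   oriented by the enumeration order of V.  A simplex of dimension i has i.+1
   vertices, and the empty face, of dimension -1, is a basis element, so that
   the homology is the reduced one. *)
Definition chain (R : pzRingType) (V : finType) (X : {set {set V}}) (i : nat)
    (c : {ffun {set V} -> R}) : Prop :=
  forall s : {set V}, c s <> 0 -> s \in X /\ #|s| = i.+1.

Definition position (V : finType) (v : V) (s : {set V}) : nat :=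
  #|[set u in s | (enum_rank u < enum_rank v)%N]|.

(* Linear extension of s |-> \sum_(v in s) (-1) ^+ position v s *: (s :\ v),
   written through its coefficients: t = s :\ v with v \in s iff s = v |: t
   with v \notin t, and then position v s = position v t. *)
Definition boundary (R : pzRingType) (V : finType) (c : {ffun {set V} -> R}) :
    {ffun {set V} -> R} :=
  [ffun t : {set V} =>
    \sum_(v | v \notin t) (-1) ^+ position v t * c (v |: t)].

Definition trivial_reduced_homology (R : pzRingType) (V : finType)
    (X : {set {set V}}) (i : nat) : Prop :=
  forall z : {ffun {set V} -> R}, chain X i z -> boundary z = 0 ->
  exists2 b : {ffun {set V} -> R}, chain X i.+1 b & boundary b = z.

Definition leray (R : pzRingType) (V : finType) (d : nat)
    (X : {set {set V}}) : Prop :=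
  forall (U : {set V}) (i : nat), (d <= i)%N ->
  trivial_reduced_homology R (induced X U) i.

Record matroid (V : finType) : Type := Matroid {
  indep : {set {set V}};
  indep0 : set0 \in indep;
  indep_sub : forall A B : {set V},
    A \subset B -> B \in indep -> A \in indep;
  indep_augment : forall A B : {set V},
    A \in indep -> B \in indep -> (#|A| < #|B|)%N ->
    exists2 x : V, x \in B :\: A & x |: A \in indep
}.

Definition matroid_rank (V : finType) (M : matroid V) (W : {set V}) : nat :=
  \max_(A in indep M | A \subset W) #|A|.

(* Main.v *)
Require Import Defs.
From HB Require Import structures.
From mathcomp Require Import all_boot all_order all_algebra.
From mathcomp Require Import zify.

(* Suppose that the complement of every face of X has rank at least k.  Let K
   consist of the sets that extend to a set of size d+1 and rank at least k; it
   is a subcomplex of X by hypothesis and a matroid complex up to small cases,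
   so K[W] is acyclic below dimension d whenever W has rank at least k.  Filling
   cycles in K below dimension d and in X (by the Leray property) from there
   on, every cycle avoiding a face s can be filled avoiding s.  This yields a
   chain map P from the cubical subdivision of X, including the empty face, to X
   that sends the cube [s, t] to a chain avoiding s.  The chains P[{v}, t],
   v in t, add up to a self-map f of the augmented chain complex of X which is
   the identity in degree -1 and has zero diagonal coefficients in the other
   degrees, so its alternating trace is -1; but the chains P[set0, t] form a
   null-homotopy of f, so the trace is 0. *)

Set Implicit Arguments.
Unset Strict Implicit.
Unset Printing Implicit Defensive.

Import GRing.Theory.
Local Open Scope ring_scope.

(** * Orientation signs and the boundary operator *)

Definition face_sign (R : pzRingType) (V : finType) (v : V) (s : {set V}) : R :=
  (-1) ^+ position v s.

Lemma position_setU1 (V : finType) (u v : V) (A : {set V}) :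
  u \notin A ->
  position v (u |: A) = ((enum_rank u < enum_rank v) + position v A)%N.
Proof.
move=> uA; rewrite /position; case: ltnP => uv.
  have -> : [set w in u |: A | (enum_rank w < enum_rank v)%N] =
      u |: [set w in A | (enum_rank w < enum_rank v)%N].
    by apply/setP => w; rewrite !inE; case: eqP => // ->; rewrite uv.
  by rewrite cardsU1 inE (negPf uA).
congr #|pred_of_set _|; apply/setP => w; rewrite !inE.
by case: eqP => //= ->; rewrite ltnNge uv andbF.
Qed.

Lemma position_setD1 (V : finType) (v : V) (A : {set V}) :
  position v (A :\ v) = position v A.
Proof.
rewrite /position; congr #|pred_of_set _|; apply/setP => w; rewrite !inE.
by case: eqP => //= ->; rewrite ltnn andbF.
Qed.

Lemma face_signD1 (R : pzRingType) (V : finType) (v : V) (A : {set V}) :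
  face_sign R v (A :\ v) = face_sign R v A.
Proof. by rewrite /face_sign position_setD1. Qed.

Lemma face_signC (R : pzRingType) (V : finType) (u v : V) (A B : {set V}) :
  face_sign R u A * face_sign R v B = face_sign R v B * face_sign R u A.
Proof. by rewrite /face_sign -!exprD addnC. Qed.

Lemma face_sign_sqr (R : pzRingType) (V : finType) (v : V) (A : {set V}) :
  face_sign R v A * face_sign R v A = 1.
Proof. by rewrite -expr2 sqrr_sign. Qed.

(** Exactly one of [u] and [v] precedes the other in the enumeration, so exactly one order of
    insertion picks up an extra sign. *)
Lemma face_sign_swap (R : pzRingType) (V : finType) (u v : V)
    (A : {set V}) :
  u != v -> u \notin A -> v \notin A ->
  face_sign R u A * face_sign R v (u |: A) =
  - (face_sign R v A * face_sign R u (v |: A)).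
Proof.
move=> uv uA vA; rewrite /face_sign !position_setU1 // -!exprD -[RHS]mulN1r
  -exprS.
have : enum_rank u != enum_rank v :> nat.
  by apply: contra_neq uv => /ord_inj /enum_rank_inj.
rewrite -[LHS]signr_odd -[RHS]signr_odd /= !oddD.
by case: ltngtP => //= _ _; do 2!case: odd.
Qed.

Lemma face_sign_setU1_mul (R : pzRingType) (V : finType) (u v : V)
    (A : {set V}) :
  u != v -> u \notin A -> v \notin A ->
  face_sign R u (v |: A) * face_sign R v (u |: A) =
  - (face_sign R v A * face_sign R u A).
Proof.
move=> uv uA vA; rewrite /face_sign !position_setU1 // -!exprD -[RHS]mulN1r
  -exprS.
have : enum_rank u != enum_rank v :> nat.
  by apply: contra_neq uv => /ord_inj /enum_rank_inj.
rewrite -[LHS]signr_odd -[RHS]signr_odd /= !oddD.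
by case: ltngtP => //= _ _; do 2!case: odd.
Qed.

(** Terms are paired along the enumeration order rather than by halving the sum, so 2 may fail to be
    invertible. *)
Lemma sum_antisymmetric (Z : zmodType) (T : finType) (F : T -> T -> Z) :
  (forall u v, u != v -> F u v = - F v u) ->
  \sum_u \sum_(v | v != u) F u v = 0.
Proof.
move=> Fswap; pose lt (u v : T) := (enum_rank u < enum_rank v)%N.
rewrite (eq_bigr (fun u => \sum_(v | lt u v) F u v + \sum_(v | lt v u) F u v)).
  rewrite big_split /= [X in _ + X](exchange_big_dep predT) //= -big_split /=.
  apply: big1 => u _; rewrite -big_split big1 //= => v uv.
  by rewrite Fswap ?addNr //; apply: contraTneq uv => ->; rewrite /lt ltnn.
move=> u _; rewrite (bigID (lt u)) /=; congr (_ + _); apply: eq_bigl => v;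
  rewrite /lt; case: eqP => [->|/eqP uv]; rewrite ?ltnn //=.
have : enum_rank u != enum_rank v :> nat.
  by apply: contra_neq uv => /ord_inj /enum_rank_inj.
by case: ltngtP.
Qed.

Lemma boundaryE (R : pzRingType) (V : finType) (c : {ffun {set V} -> R}) t :
  boundary c t = \sum_(v | v \notin t) face_sign R v t * c (v |: t).
Proof. by rewrite ffunE. Qed.

Lemma boundary_is_zmod_morphism (R : pzRingType) (V : finType) :
  zmod_morphism (@boundary R V).
Proof.
move=> c e; apply/ffunP => t; rewrite !ffunE -sumrB.
by apply: eq_bigr => v _; rewrite !ffunE mulrBr.
Qed.

HB.instance Definition _ (R : pzRingType) (V : finType) :=
  GRing.isZmodMorphism.Build {ffun {set V} -> R} {ffun {set V} -> R}
    (@boundary R V) (@boundary_is_zmod_morphism R V).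

(** Taking the sign in the ring of functions, with pointwise product, lets it multiply a chain
    directly. *)
Lemma ffun_face_signE (R : pzRingType) (T V : finType) (v : V) (A : {set V})
    (c : {ffun T -> R}) t :
  (face_sign {ffun T -> R} v A * c) t = face_sign R v A * c t.
Proof.
have signE S : face_sign S v A = (-1) ^+ odd (position v A).
  by rewrite /face_sign -signr_odd.
rewrite !signE; case: odd; first by rewrite !expr1 !mulN1r ffunE.
by rewrite !expr0 !mul1r.
Qed.

Lemma boundary_boundary (R : pzRingType) (V : finType)
    (c : {ffun {set V} -> R}) : boundary (boundary c) = 0.
Proof.
apply/ffunP => t; rewrite boundaryE ffunE.
pose F u v := if (u \notin t) && (v \notin t) then
  face_sign R u t * face_sign R v (u |: t) * c (u |: (v |: t)) else 0.
rewrite -[RHS](sum_antisymmetric (F := F)); last first.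
  move=> u v uv; rewrite /F andbC; case: ifP => [/andP[vt ut]|];
    last by rewrite oppr0.
  by rewrite face_sign_swap // mulNr setUCA.
rewrite big_mkcond; apply: eq_bigr => u _; rewrite /F; case: ifP => ut;
  last by rewrite big1.
rewrite boundaryE mulr_sumr big_mkcond [RHS]big_mkcond;
  apply: eq_bigr => v _ /=.
rewrite !inE negb_or; case: (v == u) => //=; case: ifP => // _.
by rewrite mulrA setUCA.
Qed.

(** * Cones, links and deletions of chains *)

Definition cone (R : pzRingType) (V : finType) (v : V)
    (c : {ffun {set V} -> R}) : {ffun {set V} -> R} :=
  [ffun A : {set V} => if v \in A then face_sign R v A * c (A :\ v) else 0].

Lemma coneE (R : pzRingType) (V : finType) (v : V)
    (c : {ffun {set V} -> R}) A :
  cone v c A = if v \in A then face_sign R v A * c (A :\ v) else 0.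
Proof. by rewrite ffunE. Qed.

(** The cone is a contracting homotopy of the full simplex. If [v] lies in [t], the [v]-term of
    [boundary c] at [t :\ v] cancels [c t]; otherwise only the [v]-term on the left survives. *)
Lemma boundary_cone (R : pzRingType) (V : finType) (v : V)
    (c : {ffun {set V} -> R}) :
  boundary (cone v c) = c - cone v (boundary c).
Proof.
apply/ffunP => t; rewrite boundaryE ffunE [X in _ + X]ffunE coneE.
have [vt|vt] := boolP (v \in t); last first.
  rewrite subr0 (bigD1 v) //= coneE setU11 setU1K // -(face_signD1 R v (v |:
    t)).
  rewrite setU1K // mulrA face_sign_sqr mul1r big1 ?addr0 // => u /andP[_ uv].
  by rewrite coneE !inE eq_sym (negPf uv) (negPf vt) mulr0.
rewrite boundaryE [in RHS](bigD1 v) ?setD11 //= setD1K //.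
rewrite face_signD1 mulrDr mulrA face_sign_sqr mul1r opprD addNKr mulr_sumr
  -sumrN.
apply: eq_big => [u|u ut].
  by rewrite !inE negb_and negbK; case: eqP => [->|_]; rewrite ?vt ?andbT.
have uv : u != v by apply: contraNneq ut => ->.
have utv : u \notin t :\ v by rewrite !inE (negPf ut) andbF.
rewrite coneE !inE vt orbT -(face_signD1 R v (u |: t)).
have -> : (u |: t) :\ v = u |: (t :\ v).
  apply/setP => w; rewrite !inE; case: (w =P v) => //= ->.
  by rewrite eq_sym (negPf uv).
have := face_sign_setU1_mul R uv utv (negbT (setD11 v t)).
by rewrite setD1K // face_signD1 !mulrA => ->; rewrite mulNr.
Qed.

(* [n] counts vertices, so [n = 0] is the augmentation degree, and
   [sized_chain X i.+1] is [chain X i]. *)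
Definition sized_chain (R : pzRingType) (V : finType) (X : {set {set V}})
    (n : nat) (c : {ffun {set V} -> R}) : Prop :=
  forall s : {set V}, c s <> 0 -> s \in X /\ #|s| = n.

Lemma sized_chainP (R : pzRingType) (V : finType) (X : {set {set V}}) n
    (c : {ffun {set V} -> R}) :
  sized_chain X n c <-> forall s, c s != 0 -> (s \in X) && (#|s| == n).
Proof.
split=> cX s.
  by move/eqP/cX => [-> ->] /=.
by move/eqP/cX/andP => [-> /eqP].
Qed.

Lemma sized_chainD (R : pzRingType) (V : finType) (X : {set {set V}}) n
    (c e : {ffun {set V} -> R}) :
  sized_chain X n c -> sized_chain X n e -> sized_chain X n (c + e).
Proof.
move=> /sized_chainP cX /sized_chainP eX; apply/sized_chainP => s.
rewrite ffunE; have [->|/cX->//] := eqVneq (c s) 0.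
by rewrite add0r; apply: eX.
Qed.

Lemma sized_chainN (R : pzRingType) (V : finType) (X : {set {set V}}) n
    (c : {ffun {set V} -> R}) :
  sized_chain X n c -> sized_chain X n (- c).
Proof.
move=> /sized_chainP cX; apply/sized_chainP => s.
by rewrite ffunE oppr_eq0; apply: cX.
Qed.

Lemma sized_chain_sum (R : pzRingType) (V : finType) (X : {set {set V}}) n
    (I : finType) (P : pred I) (c : I -> {ffun {set V} -> R}) :
  (forall i, P i -> sized_chain X n (c i)) ->
  sized_chain X n (\sum_(i | P i) c i).
Proof.
move=> cX; apply: big_ind => //; last exact: sized_chainD.
by move=> s; rewrite ffunE.
Qed.

Lemma sized_chain_sign (R : pzRingType) (V W : finType) (X : {set {set V}}) n
    (v : W) (A : {set W}) (c : {ffun {set V} -> R}) :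
  sized_chain X n c -> sized_chain X n (face_sign {ffun {set V} -> R} v A * c).
Proof.
move=> cX s; rewrite ffun_face_signE => cs; apply: cX => c0.
by rewrite c0 mulr0 in cs.
Qed.

Lemma sub_sized_chain (R : pzRingType) (V : finType) (X Y : {set {set V}}) n
    (c : {ffun {set V} -> R}) :
  X \subset Y -> sized_chain X n c -> sized_chain Y n c.
Proof. by move=> /subsetP XY cX s /cX[/XY]. Qed.

Definition acyclic_at (R : pzRingType) (V : finType) (X : {set {set V}})
    (n : nat) : Prop :=
  forall z : {ffun {set V} -> R}, sized_chain X n z -> boundary z = 0 ->
  exists2 b : {ffun {set V} -> R}, sized_chain X n.+1 b & boundary b = z.

Lemma acyclic_at_cone (R : pzRingType) (V : finType) (X : {set {set V}})
    (n : nat) (v : V) :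
  (forall A, A \in X -> #|A| = n -> v |: A \in X) -> acyclic_at R X n.
Proof.
move=> Xv z zX dz; exists (cone v z); last first.
  rewrite boundary_cone dz; apply/ffunP => A.
  by rewrite 2!ffunE coneE ffunE mulr0 if_same subr0.
apply/sized_chainP => A; rewrite coneE.
case: ifP => [vA|]; last by rewrite eqxx.
have [->|/eqP/zX[AX An] _] := eqVneq (z (A :\ v)) 0;
  first by rewrite mulr0 eqxx.
by rewrite -(setD1K vA) Xv // cardsU1 setD11 An eqxx.
Qed.

Definition deleted_chain (R : pzRingType) (V : finType) (v : V)
    (c : {ffun {set V} -> R}) : {ffun {set V} -> R} :=
  [ffun A : {set V} => if v \in A then 0 else c A].

Definition link_chain (R : pzRingType) (V : finType) (v : V)
    (c : {ffun {set V} -> R}) : {ffun {set V} -> R} :=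
  [ffun A : {set V} => if v \in A then 0 else face_sign R v A * c (v |: A)].

Lemma deleted_chain_link (R : pzRingType) (V : finType) (v : V)
    (c : {ffun {set V} -> R}) :
  c = deleted_chain v c + cone v (link_chain v c).
Proof.
apply/ffunP => A; rewrite ffunE coneE !ffunE setD11.
case: ifP => vA; last by rewrite addr0.
by rewrite setD1K // face_signD1 mulrA face_sign_sqr mul1r add0r.
Qed.

Lemma boundary_link_chain (R : pzRingType) (V : finType) (v : V)
    (c : {ffun {set V} -> R}) :
  boundary (link_chain v c) = - link_chain v (boundary c).
Proof.
apply/ffunP => t; rewrite boundaryE [RHS]ffunE [X in - X]ffunE.
case: ifP => vt.
  by rewrite oppr0 big1 // => u _; rewrite ffunE !inE vt orbT mulr0.
rewrite (bigD1 v) ?vt //= ffunE setU11 mulr0 add0r boundaryE mulr_sumr -sumrN.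
apply: eq_big => [u|u /andP[ut uv]]; first by rewrite !inE negb_or andbC.
rewrite ffunE !inE eq_sym (negPf uv) vt /= !mulrA setUCA.
by rewrite (face_sign_swap R uv) ?vt // mulNr.
Qed.

(** Mayer-Vietoris on chains: the part of a cycle on faces containing [v] is the cone over a cycle
    [b] of the link. Filling [b] by [c] in the link replaces that part by [c], leaving a cycle of
    the deletion. *)
Lemma acyclic_at_delete (R : pzRingType) (V : finType)
    (X : {set {set V}}) (n : nat) (v : V) :
  (forall A : {set V}, v \notin A -> v |: A \in X -> A \in X) ->
  ((0 < n)%N -> acyclic_at R [set A : {set V} | (v \notin A) && (v |: A \in X)]
    n.-1) ->
  acyclic_at R [set A : {set V} in X | v \notin A] n ->
  acyclic_at R X n.
Proof.
move=> X_del; set L := [set A | _]; set D := [set A in X | _] => L_acyclic.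
move=> D_acyclic z zX dz; set a := deleted_chain v z; set b := link_chain v z.
have DX : D \subset X by apply/subsetP => A; rewrite inE => /andP[].
have aD : sized_chain D n a.
  move=> A; rewrite ffunE; case: ifP => // vA /zX[AX An].
  by rewrite inE AX vA.
have bL A : b A <> 0 -> A \in L /\ #|A|.+1 = n.
  rewrite ffunE; case: ifP => // vA.
  have [->|/eqP/zX[AX An] _] := eqVneq (z (v |: A)) 0; first by rewrite mulr0.
  by rewrite inE vA AX -An cardsU1 vA.
have db : boundary b = 0.
  rewrite boundary_link_chain dz; apply/ffunP => A.
  by rewrite !ffunE mulr0 if_same oppr0.
have [c cL dc] : exists2 c, sized_chain L n c & boundary c = b.
  (* For [n = 0] no face of size [n] contains [v], so [b] vanishes and [c = 0] fills it. *)
  case: n zX L_acyclic aD bL D_acyclic => [|n] zX L_acyclic aD bL D_acyclic.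
    exists 0; first by move=> A; rewrite ffunE.
    by rewrite raddf0; apply/ffunP => A; rewrite [LHS]ffunE; apply/esym/eqP;
      apply: contraT => /eqP/bL[].
  by apply: L_acyclic => // A /bL[AL [An]].
have cD : sized_chain D n c.
  move=> A /cL[]; rewrite !inE => /andP[vA vAX] ->.
  by rewrite vA X_del.
have zE : z = a + c - boundary (cone v c).
  rewrite boundary_cone dc opprB addrA addrAC addrK.
  exact: deleted_chain_link.
have dac : boundary (a + c) = 0.
  rewrite -[a + c](subrK (boundary (cone v c))) -zE raddfD /= dz.
  by rewrite boundary_boundary addr0.
have [e eD de] := D_acyclic _ (sized_chainD aD cD) dac.
exists (e - cone v c); last by rewrite raddfB /= de -zE.
apply: sized_chainD (sub_sized_chain DX eD) (sized_chainN _).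
apply/sized_chainP => A; rewrite coneE; case: ifP => [vA|];
  last by rewrite eqxx.
have [->|/eqP/cL[AX An] _] := eqVneq (c (A :\ v)) 0;
  first by rewrite mulr0 eqxx.
move: AX; rewrite inE setD1K // => /andP[_ ->] /=.
by rewrite -(setD1K vA) cardsU1 setD11 An eqxx.
Qed.

(** * Acyclicity of elongations of rank functions *)

Section RankFunctions.
Local Open Scope nat_scope.

(** The last clause is submodularity in local form. The value at the empty set is left free, so that
    contracting [v] just inserts [v] in the argument and keeps the threshold [k]. *)
Definition rank_function (V : finType) (r : {set V} -> nat) : Prop :=
  [/\ forall A B : {set V}, A \subset B -> r A <= r B,
      forall (v : V) (A : {set V}), r (v |: A) <= (r A).+1
    & forall (v : V) (A B : {set V}),
        A \subset B -> r B < r (v |: B) -> r A < r (v |: A)].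

Lemma rank_function_contract (V : finType) (r : {set V} -> nat) (v : V) :
  rank_function r -> rank_function (fun A => r (v |: A)).
Proof.
move=> [r_mono r_unit r_sub]; split=> [A B AB|u A|u A B AB].
- by apply: r_mono; apply: setUS.
- by rewrite setUCA; apply: r_unit.
- by rewrite !(setUCA [set v]); apply: r_sub; apply: setUS.
Qed.

(* When [k <= r W <= #|W|] and [k <= m <= #|W|], these are the sets contained in
   some [B \subset W] with [#|B| = m] and [k <= r B]. *)
Definition elongation (V : finType) (r : {set V} -> nat) (k m : nat)
    (W : {set V}) : {set {set V}} :=
  [set A : {set V} | (A \subset W) && (#|A| + (k - r A) <= m)].

(* Delete a vertex v, whose link is an elongation of the contraction of v; the
   complex is a cone over v when v is needed to reach rank k. *)
Lemma elongation_acyclic (R : pzRingType) (V : finType)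
    (r : {set V} -> nat) (k m n : nat) (W : {set V}) :
  rank_function r -> W != set0 -> k <= r W -> n < m ->
  acyclic_at R (elongation r k m W) n.
Proof.
have [N] := ubnP #|W|; elim: N W r m n => // N IH W r m n WN r_rank W0 rW nm.
have [r_mono r_unit r_sub] := r_rank.
have [/exists_inP[v vW rWv]|] := boolP [exists v in W, r (W :\ v) < k].
  apply: (acyclic_at_cone (v := v)) => A; rewrite !inE => /andP[AW Am] An.
  rewrite subUset sub1set vW AW /=.
  have [vA|vA] := boolP (v \in A).
    by rewrite (setUidPr _) ?sub1set.
  have AWv : A \subset W :\ v by rewrite subsetD1 AW.
  (* By submodularity [v] raises the rank of [A], which is below [k]: the deficit [k - r A] drops as
     the size grows by one. *)
  have := r_mono _ _ AWv; have := r_sub v _ _ AWv.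
  rewrite setD1K // cardsU1 vA => /(_ (leq_trans rWv rW)); lia.
rewrite negb_exists_in => /forall_inP W_no_coloop.
have [v vW] := set0Pn _ W0.
have rWv : k <= r (W :\ v) by rewrite leqNgt W_no_coloop.
(* If [W] is a single vertex, then [k <= r set0], all deficits are zero, and [n < m] leaves room for
   [v]. *)
have [Wv0|Wv0] := eqVneq (W :\ v) set0.
  apply: (acyclic_at_cone (v := v)) => A; rewrite !inE => /andP[AW Am] An.
  rewrite subUset sub1set vW AW /= cardsU1.
  have := r_mono _ _ (sub0set (v |: A)); rewrite -Wv0; case: (v \notin A); lia.
have WvN : #|W :\ v| < N by move: WN; rewrite (cardsD1 v) vW.
apply: (acyclic_at_delete (v := v)) => [A vA|n0|].
- rewrite !inE subUset sub1set vW cardsU1 vA /= => /andP[-> /=].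
  have := r_unit v A; lia.
- have -> : [set A : {set V} | (v \notin A) && (v |: A \in elongation r k m W)]
    =
      elongation (fun A => r (v |: A)) k m.-1 (W :\ v).
    apply/setP => A; rewrite !inE subUset sub1set vW subsetD1 /= andbCA -andbA.
    case: (A \subset W) => //=; case: (boolP (v \in A)) => //= vA.
    by rewrite cardsU1 vA; lia.
  apply: IH => //; first exact: rank_function_contract.
  + by rewrite setD1K.
  + lia.
- have -> : [set A : {set V} in elongation r k m W | v \notin A] =
      elongation r k m (W :\ v).
    by apply/setP => A; rewrite !inE subsetD1 andbAC.
  exact: IH.
Qed.

(** * Bases and rank in a matroid *)

Lemma rank_ge (V : finType) (M : matroid V) (I W : {set V}) :
  I \in indep M -> I \subset W -> #|I| <= matroid_rank M W.
Proof.
move=> iI IW; apply: (leq_bigmax_cond (F := fun A : {set V} => #|A|)).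
by rewrite iI.
Qed.

Lemma indep_extend (V : finType) (M : matroid V) (I W : {set V}) :
  I \in indep M -> I \subset W ->
  exists J : {set V}, [/\ J \in indep M, I \subset J, J \subset W
                       & #|J| = matroid_rank M W].
Proof.
have [B iBW rB] : {B | (B \in indep M) && (B \subset W) & matroid_rank M W =
  #|B|}.
  apply: eq_bigmax_cond; apply/card_gt0P; exists set0.
  by rewrite unfold_in indep0 sub0set.
case/andP: iBW => iB BW.
have [N] := ubnP (#|B| - #|I|); elim: N I => // N IH I IN iI IW.
have [IB|BI] := ltnP #|I| #|B|; last first.
  exists I; split=> //; apply/eqP; rewrite eqn_leq rank_ge //= rB.
  exact: BI.
have [x /setDP[xB xI] ixI] := indep_augment iI iB IB.
have [||J [iJ xIJ JW Jr]] := IH (x |: I) _ ixI.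
- by rewrite cardsU1 xI; lia.
- by rewrite subUset sub1set (subsetP BW) ?IW.
by exists J; split=> //; apply: subset_trans xIJ; apply: subsetUr.
Qed.

Lemma matroid_rank0 (V : finType) (M : matroid V) : matroid_rank M set0 = 0.
Proof.
have [J [_ _ J0 <-]] := indep_extend (indep0 M) (sub0set set0).
by apply/eqP; rewrite cards_eq0 -subset0.
Qed.

Lemma matroid_rank_function (V : finType) (M : matroid V) :
  rank_function (matroid_rank M).
Proof.
split=> [A B AB|v A|v A B AB rB].
- have [J [iJ _ JA <-]] := indep_extend (indep0 M) (sub0set A).
  exact: rank_ge iJ (subset_trans JA AB).
- have [J [iJ _ JA <-]] := indep_extend (indep0 M) (sub0set (v |: A)).
  rewrite (cardsD1 v); have : #|J :\ v| <= matroid_rank M A.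
    by apply: rank_ge; [apply: indep_sub iJ; apply: subD1set | rewrite subDset].
  by case: (v \in J); lia.
(* Extend a basis [I] of [A] to a basis [J] of [B]. Augmenting [J] from a basis of [v |: B] can only
   add [v], as [J] is maximal in [B]; hence [v |: I] is independent. *)
have [I [iI _ IA Ir]] := indep_extend (indep0 M) (sub0set A).
have [J [iJ IJ JB Jr]] := indep_extend iI (subset_trans IA AB).
have [K [iK _ KB Kr]] := indep_extend (indep0 M) (sub0set (v |: B)).
have [|x /setDP[xK xJ] ixJ] := indep_augment iJ iK; first by rewrite Jr Kr.
have xv : x = v.
  apply: contraTeq rB => xv; rewrite -leqNgt.
  have xB : x \in B by move/subsetP: KB => /(_ _ xK); rewrite !inE (negPf xv).
  have := rank_ge ixJ (_ : x |: J \subset B); rewrite subUset sub1set xB JB.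
  by rewrite cardsU1 xJ => /(_ isT); rewrite Jr ltnn.
rewrite xv in xJ ixJ; rewrite -Ir.
have vI : v \notin I by apply: contra xJ; apply: (subsetP IJ).
have <- : #|v |: I| = #|I|.+1 by rewrite cardsU1 vI.
by apply: rank_ge; [apply: indep_sub ixJ; apply: setUS | apply: setUS].
Qed.

Lemma exists_rank_increase (V : finType) (M : matroid V) (A : {set V}) :
  matroid_rank M A < matroid_rank M [set: V] ->
  exists2 v, v \notin A & matroid_rank M A < matroid_rank M (v |: A).
Proof.
have [I [iI _ IA Ir]] := indep_extend (indep0 M) (sub0set A).
have [J [iJ _ _ <-]] := indep_extend (indep0 M) (sub0set [set: V]).
rewrite -Ir => /(indep_augment iI iJ)[x /setDP[_ xI] ixI].
have rxA : #|I| < matroid_rank M (x |: A).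
  have <- : #|x |: I| = #|I|.+1 by rewrite cardsU1 xI.
  by apply: rank_ge => //; apply: setUS.
exists x => //; apply: contraTN rxA => xA.
by rewrite (setUidPr _) ?sub1set // -leqNgt Ir.
Qed.

(** While [A] has at most [d] elements it does not span, so some [v] raises its rank: this lowers a
    positive deficit, and a zero deficit leaves room for [v]. At size [d.+1] the deficit is zero. *)
Lemma elongation_faces (V : finType) (X : {set {set V}}) (M : matroid V)
    (d k : nat) (A : {set V}) :
  simplicial_complex X -> d < matroid_rank M [set: V] ->
  (forall s : {set V}, #|s| = d.+1 -> k <= matroid_rank M s -> s \in X) ->
  #|A| + (k - matroid_rank M A) <= d.+1 -> A \in X.
Proof.
move=> X_complex M_rank X_contains.
have [N] := ubnP (d.+1 - #|A|); elim: N A => // N IH A AN Ad.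
have [dA|dA] := leqP d.+1 #|A|; first by apply: X_contains; lia.
have rA : matroid_rank M A <= #|A|.
  have [I [_ _ IA <-]] := indep_extend (indep0 M) (sub0set A).
  exact: subset_leq_card.
have [|v vA rvA] := @exists_rank_increase _ M A; first by lia.
have cA : #|v |: A| = #|A|.+1 by rewrite cardsU1 vA.
by apply: X_complex (subsetUr [set v] A); apply: IH; rewrite cA; lia.
Qed.
End RankFunctions.

(** * Chain maps from the cubical complex *)

Lemma subrACA (Z : zmodType) : @interchange Z (fun x y => x - y) (fun x y => x
  - y).
Proof. by move=> x y z t; rewrite opprD addrACA -opprD. Qed.

(* [cube_boundary P s D] is what the boundary of [P s D] must be for [P] to be
   an augmented chain map from the cubical complex whose cubes are the intervals
   [[s, s :|: D]]; [P s set0] is a vertex chain of augmentation [1]. *)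
Definition cube_boundary (R : pzRingType) (V : finType)
    (P : {set V} -> {set V} -> {ffun {set V} -> R}) (s D : {set V}) :
    {ffun {set V} -> R} :=
  [ffun A : {set V} => ((A == set0) && (D == set0))%:R] +
  \sum_(v in D) face_sign _ v D * (P (v |: s) (D :\ v) - P s (D :\ v)).

(** Directions [v] and [u] contribute a mixed second difference of [P], symmetric in them, with an
    antisymmetric sign. *)
Lemma cube_boundary_boundary (R : pzRingType) (V : finType)
    (P : {set V} -> {set V} -> {ffun {set V} -> R}) (s D : {set V}) :
  (forall v, v \in D ->
    boundary (P (v |: s) (D :\ v)) = cube_boundary P (v |: s) (D :\ v) /\
    boundary (P s (D :\ v)) = cube_boundary P s (D :\ v)) ->
  boundary (cube_boundary P s D) = 0.
Proof.
move=> dP; rewrite raddfD raddf_sum /= [boundary _](_ : _ = 0) ?add0r;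
  last first.
  apply/ffunP => A; rewrite boundaryE ffunE big1 // => v _.
  by rewrite ffunE -subset0 subUset sub1set inE mulr0.
pose F v u : {ffun {set V} -> R} := if (v \in D) && (u \in D) then
  face_sign _ v D * face_sign _ u (D :\ v) *
    (P (u |: (v |: s)) (D :\ v :\ u) - P (v |: s) (D :\ v :\ u)
     - (P (u |: s) (D :\ v :\ u) - P s (D :\ v :\ u))) else 0.
rewrite -[RHS](sum_antisymmetric (F := F)); last first.
  move=> v u vu; rewrite /F andbC; case: ifP => [/andP[uD vD]|];
    last by rewrite oppr0.
  have -> : D :\ u :\ v = D :\ v :\ u by rewrite !setDDl setUC.
  set E := D :\ v :\ u; have vE : v \notin E by rewrite !inE eqxx andbF.
  have uE : u \notin E by rewrite !inE eqxx.
  rewrite -(face_signD1 _ v D) -(face_signD1 _ u D).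
  have -> : D :\ v = u |: E by rewrite setD1K // !inE eq_sym vu.
  have -> : D :\ u = v |: E.
    by apply/setP => w; rewrite !inE; case: (w =P v) => [->|] //=; rewrite vu.
  rewrite (setUCA [set u]) [X in _ * X]subrACA -(face_signD1 _ u (u |: E)).
  rewrite -(face_signD1 _ v (v |: E)) !setU1K // face_signC.
  by rewrite face_sign_swap 1?eq_sym // mulNr (face_signC _ v u).
rewrite big_mkcond; apply: eq_bigr => v _; rewrite /F.
case: ifP => vD; last by rewrite big1.
rewrite /face_sign raddfMsign raddfB /= -/(face_sign _ v D).
(* The augmentation terms of opposite facets depend only on [D :\ v] and cancel. *)
have [-> ->] := dP v vD; rewrite opprD addrACA subrr add0r -sumrB mulr_sumr.
rewrite big_mkcond [RHS]big_mkcond; apply: eq_bigr => u _ /=.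
by rewrite !inE; case: (u != v); case: (u \in D) => //=; rewrite -mulrBr mulrA.
Qed.

(** By induction on the dimension of the cube: the chains of its facets avoid [s] or [v |: s], so
    the prescribed boundary is a cycle avoiding [s] and is filled there. *)
Lemma cube_chain_map (R : pzRingType) (V : finType) (X F : {set {set V}}) :
  simplicial_complex X -> set0 \in F ->
  (forall s n, s \in X -> acyclic_at R (induced F (~: s)) n) ->
  exists P : {set V} -> {set V} -> {ffun {set V} -> R},
  forall s D : {set V}, [disjoint s & D] -> s :|: D \in X ->
    sized_chain (induced F (~: s)) #|D|.+1 (P s D) /\
    boundary (P s D) = cube_boundary P s D.
Proof.
move=> X_complex F0 F_acyclic.
suff [P PP] : exists P : {set V} -> {set V} -> {ffun {set V} -> R},
    forall s D : {set V}, (#|D| < #|V|.+1)%N -> [disjoint s & D] ->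
      s :|: D \in X ->
      sized_chain (induced F (~: s)) #|D|.+1 (P s D) /\
      boundary (P s D) = cube_boundary P s D.
  by exists P => s D; apply: PP; rewrite ltnS max_card.
elim: #|V|.+1 => [|N [P PP]]; first by exists (fun _ _ => 0).
(* Finite choice fills all cubes of dimension [N] at once and keeps the values of [P] on smaller
   ones. *)
have /fin_all_exists[Q QP] : forall sD : {set V} * {set V},
    exists q : {ffun {set V} -> R},
      ((#|sD.2| < N)%N -> q = P sD.1 sD.2) /\
      (#|sD.2| = N -> [disjoint sD.1 & sD.2] -> sD.1 :|: sD.2 \in X ->
       sized_chain (induced F (~: sD.1)) N.+1 q /\
       boundary q = cube_boundary P sD.1 sD.2).
  move=> [s D] /=.
  have [DN|DN] := eqVneq #|D| N; last first.
    by exists (P s D); split=> // DN'; rewrite DN' eqxx in DN.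
  rewrite DN ltnn.
  have [/andP[sD sDX]|no_cube] := boolP ([disjoint s & D] && (s :|: D \in X));
    last first.
    by exists 0; split=> // _ sD sDX; rewrite sD sDX in no_cube.
  have facet v : v \in D ->
    [/\ (#|D :\ v| < N)%N, [disjoint v |: s & D :\ v], v |: s :|: D :\ v \in X,
        [disjoint s & D :\ v] & s :|: D :\ v \in X].
    move=> vD; split.
    - by rewrite -DN (cardsD1 v D) vD.
    - rewrite -setI_eq0 -subset0; apply/subsetP => w; rewrite !inE.
      case: eqP => //= _ /andP[ws wD].
      by rewrite (disjointFr sD ws) in wD.
    - by rewrite -setUA setUCA setD1K.
    - by apply: disjointWr sD; apply: subD1set.
    - by apply: X_complex sDX _; apply/setUS/subD1set.
  have [|||q qF dq] := @F_acyclic s N _ (cube_boundary P s D).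
  - exact: X_complex sDX (subsetUl _ _).
  - apply: sized_chainD.
      apply/sized_chainP => A; rewrite ffunE.
      case: (A =P set0) => [->|]; last by rewrite eqxx.
      case: (D =P set0) => [D0 _|]; last by rewrite eqxx.
      by rewrite inE F0 sub0set cards0 -DN D0 cards0.
    apply: sized_chain_sum => v vD; apply: sized_chain_sign.
    have [Dv d1 X1 d2 X2] := facet v vD.
    have <- : #|D :\ v|.+1 = N by rewrite -DN (cardsD1 v D) vD.
    apply: sized_chainD; last by apply: sized_chainN;
      have [] := PP _ _ Dv d2 X2.
    have [+ _] := PP _ _ Dv d1 X1; apply: sub_sized_chain.
    apply/subsetP => A; rewrite !inE => /andP[-> /subset_trans-> //].
    by rewrite setCS subsetUr.
  - apply: cube_boundary_boundary => v vD.
    have [Dv d1 X1 d2 X2] := facet v vD.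
    by split; [case: (PP _ _ Dv d1 X1) | case: (PP _ _ Dv d2 X2)].
  by exists q; split.
have QE (s D : {set V}) : (#|D| <= N)%N ->
    cube_boundary (fun s D => Q (s, D)) s D = cube_boundary P s D.
  move=> DN; rewrite /cube_boundary; congr (_ + _); apply: eq_bigr => v vD.
  have Dv : (#|D :\ v| < N)%N by move: DN; rewrite (cardsD1 v D) vD.
  by rewrite !(proj1 (QP (_, _))).
exists (fun s D => Q (s, D)) => s D; rewrite ltnS leq_eqVlt => DN sD sDX.
rewrite QE; last by rewrite leq_eqVlt.
have [Qlt Qeq] := QP (s, D); case/orP: DN => [/eqP DN|DN].
  by rewrite DN; apply: Qeq.
by rewrite Qlt //; apply: PP.
Qed.

(** * The contradiction between the two traces *)

Lemma not_all_acyclic (R : nzRingType) (V : finType) (X F : {set {set V}}) :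
  simplicial_complex X -> F \subset X -> set0 \in F ->
  ~ (forall s n, s \in X -> acyclic_at R (induced F (~: s)) n).
Proof.
move=> X_complex FX F0 F_acyclic.
have [P PP] := cube_chain_map X_complex F0 F_acyclic.
have P0 s : s \in X -> (forall A, P set0 s A != 0 -> A \in X) /\
    boundary (P set0 s) = cube_boundary P set0 s.
  move=> sX; have [||PF dP] := PP set0 s.
  - by rewrite -setI_eq0 set0I.
  - by rewrite set0U.
  split=> // A /eqP/PF[]; rewrite inE => /andP[AF _] _.
  exact: (subsetP FX).
have Pv (v : V) (s : {set V}) :
    v \in s -> s \in X -> P (v |: set0) (s :\ v) s = 0.
  move=> vs sX; have [||PF _] := PP (v |: set0) (s :\ v).
  - by rewrite setU0 disjoints1 setD11.
  - by rewrite setU0 setD1K.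
  apply/eqP; apply: contraT => /eqP/PF[].
  by rewrite inE setU0 subsetC sub1set inE vs andbF.
(* For [s] in [X], [a s v] is the contribution of [v] to the coefficient at [s] of the boundary of
   [P set0 s]. *)
pose a (s : {set V}) (v : V) := if (s \in X) && (v \notin s) then
  face_sign R v s * P set0 s (v |: s) else 0.
pose g (s : {set V}) (v : V) := (-1) ^+ #|s| * a s v.
(* The boundary identity is read at [s] itself, where the chains [P (v |: set0) (s :\ v)] vanish
   since they avoid [v]. *)
have aE (s : {set V}) :
    s \in X ->
    \sum_v a s v = (s == set0)%:R - \sum_(v in s) a (s :\ v) v.
  move=> sX; have [_ /ffunP/(_ s)] := P0 s sX.
  rewrite boundaryE big_mkcond /a sX => dPs.
  rewrite dPs ffunE ffunE andbb; congr (_ + _).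
  rewrite sum_ffunE -sumrN; apply: eq_bigr => v vs.
  rewrite ffun_face_signE 2!ffunE Pv // add0r setD11 setD1K // andbT.
  by rewrite (X_complex _ _ sX (subD1set _ _)) face_signD1 mulrN.
(* The trace of the null-homotopic map, computed in two ways. *)
have gE : \sum_s \sum_v g s v = 1 + \sum_s \sum_v g s v.
  have {1}-> : \sum_s \sum_v g s v =
     \sum_(s in X) (-1) ^+ #|s| * ((s == set0)%:R - \sum_(v in s) a (s :\ v) v).
    rewrite [RHS]big_mkcond; apply: eq_bigr => s _; rewrite -mulr_sumr.
    case: ifP => [/aE->//|sX]; rewrite big1 ?mulr0 // => v _.
    by rewrite /a sX.
  under eq_bigr do rewrite mulrBr.
  rewrite sumrB (bigD1 set0) ?(subsetP FX) //= eqxx cards0 mulr1 big1 ?addr0.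
    congr (_ + _); rewrite [RHS]exchange_big -sumrN /=.
    (* The change of parity from [s] to [s :\ v] absorbs the minus sign; reindexing by [v |: s] then
       recovers the full sum of [g]. *)
    transitivity (\sum_(s in X) \sum_(v in s) g (s :\ v) v).
      apply: eq_bigr => s _; rewrite mulr_sumr -sumrN; apply: eq_bigr => v vs.
      by rewrite /g (cardsD1 v s) vs exprS mulN1r mulNr opprK.
    rewrite (exchange_big_dep predT) //=; apply: eq_bigr => v _.
    rewrite (reindex_onto (fun s => v |: s) (fun s => s :\ v)) /=; last first.
      by move=> s /andP[_ vs]; rewrite setD1K.
    rewrite big_mkcond; apply: eq_bigr => s _; rewrite setU11 andbT.
    have [vs|vs] := boolP (v \in s).
      rewrite /g /a vs andbF mulr0; case: eqP => [E|]; last by rewrite andbF.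
      by move: vs; rewrite -E setD11.
    rewrite setU1K // eqxx andbT; case: ifP => // vsX; rewrite /g /a vs andbT.
    case: ifP => [sX|]; last by rewrite mulr0.
    (* Here [v |: s] is not in [X], and [P set0 s] is supported on [X]. *)
    have [Ps _] := P0 s sX; case: (eqVneq (P set0 s (v |: s)) 0) => [->|/Ps].
      by rewrite !mulr0.
    by rewrite vsX.
  by move=> s /andP[_ /negPf->]; rewrite mulr0.
have := oner_neq0 R; rewrite -(addrK (\sum_s \sum_v g s v) 1) -gE subrr eqxx.
by [].
Qed.

(* Joining matroid acyclicity to the Leray property *)
Local Close Scope ring_scope.

Theorem theorem5p1 (R : idomainType) (V : finType) (X : {set {set V}})
    (M : matroid V) (d k : nat)
    (X_complex : simplicial_complex X)
    (X_leray : leray R d X)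
    (M_rank : d + 1 <= matroid_rank M [set: V])
    (k_bounds : 1 <= k <= d + 1)
    (X_contains : forall s : {set V},
      #|s| = d + 1 -> k <= matroid_rank M s -> s \in X) :
  exists2 t : {set V}, t \in X & matroid_rank M (~: t) <= k - 1.
Proof.
apply/exists_inP; apply: contraT; rewrite negb_exists_in => /forall_inP rk.
rewrite addn1 in M_rank k_bounds X_contains; case/andP: k_bounds => k_gt0 k_le.
have {}rk t : t \in X -> k <= matroid_rank M (~: t) by move/rk; lia.
pose K := elongation (matroid_rank M) k d.+1.
have KX W : K W \subset X.
  apply/subsetP => A; rewrite inE => /andP[_].
  exact: elongation_faces.
(* Filling a cycle on faces with [n] vertices uses faces with [n.+1]: those of size at most [d.+1]
   must come from [K], while larger ones may be any faces of [X]. *)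
pose F := [set A in X | (#|A| <= d.+1) ==> (A \in K [set: V])].
have FX : F \subset X by apply/subsetP => A; rewrite inE => /andP[].
exfalso; apply: (@not_all_acyclic R V X F) => //.
  have K0 W : set0 \in K W by rewrite inE sub0set cards0; lia.
  by rewrite inE (subsetP (KX _) _ (K0 set0)) K0 implybT.
move=> s n /rk rs z zF dz; have [nd|dn] := leqP n d.
  have W0 : ~: s != set0.
    by apply: contraTneq rs => ->; rewrite matroid_rank0 -ltnNge.
  have K_acyclic : acyclic_at R (K (~: s)) n.
    exact: elongation_acyclic (matroid_rank_function M) W0 rs _.
  have [|b bK db] := K_acyclic z _ dz.
    move=> A /zF[]; rewrite !inE subsetT => /andP[/andP[AX /implyP AK] As] An.
    by rewrite As AK // An leqW.
  exists b => // A /bK[AK An]; rewrite !inE An ltnS nd subsetT /=.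
  rewrite (subsetP (KX _) _ AK).
  by move: AK; rewrite inE An => /andP[-> ->].
(* Faces with [n] vertices have dimension [n.-1 >= d]; the filling has faces of size above [d.+1],
   where [F] agrees with [X]. *)
have [||b bX db] := X_leray (~: s) n.-1 _ z _ dz.
- by lia.
- move=> A /zF[]; rewrite !inE => /andP[/andP[AX _] As] An.
  by rewrite AX As An (ltn_predK dn).
exists b => // A /bX[]; rewrite (ltn_predK dn) !inE => /andP[AX As] An.
by rewrite AX As An /= ltnS leqNgt dn.
Qed.
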